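(* Let $\Delta$ be a flag simplicial complex and suppose that $\tilde U$ is a one-dimensional binary geometry for $\Delta$. Then $\Delta$ consists of two isolated vertices and $\tilde U\cong\mathbb{C}$.
   Context: A simplicial complex $\Delta$ on $[n]=\{1,\dots,n\}$ is a non-empty collection of subsets of $[n]$ (called faces) closed under taking subsets. Its dimension is the size of its largest face minus one. $\Delta$ is a flag complex if $\{i\}\in\Delta$ for each $i\in[n]$, and for $r>2$, $\{a_1,\dots,a_r\}\in\Delta$ whenever all pairs $\{a_i,a_j\}\in\Delta$. Write $i\sim j$ (compatible) if $\{i,j\}\in\Delta$, and $i\not\sim j$ otherwise (so $i\sim i$). For $S\subset[n]$ let $H_S\subset\mathbb{C}^n$ be the coordinate subspace where $u_s=0$ for all $s\in S$. A binary geometry for a flag complex $\Delta$ on $[n]$ is an affine algebraic variety $\tilde U\subset\mathbb{C}^n$ (coordinates $u_1,\dots,u_n$) of dimension $\dim\tilde U=\dim\Delta+1$ cut out by $n$ equations of the form $$R_i:=u_i+\prod_{j\,:\,j\not\sim i}u_j^{a_{ij}}-1=0,\qquad i=1,\dots,n,$$ for integers $a_{ij}>0$ (an empty product equals $1$), such that: for a subset $S\subset[n]$, the subvariety $\tilde U_S:=\tilde U\cap H_S$ is non-empty exactly when $S\in\Delta$, and in this case $\tilde U_S$ is irreducible and pure of codimension $|S|$ in $\tilde U$. *)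

(* Defs.v *)
From mathcomp Require Import all_boot all_order all_algebra.
From mathcomp Require Import boolp classical_sets reals.
From mathcomp Require Export complex.
From mathcomp Require Import mpoly.

Set Implicit Arguments.
Unset Strict Implicit.
Unset Printing Implicit Defensive.

Import GRing.Theory.
Local Open Scope classical_set_scope.
Local Open Scope ring_scope.

Definition simplicial_complex (n : nat) (D : {set {set 'I_n}}) : Prop :=
  D <> finset.set0 /\
  forall A B : {set 'I_n}, A \in D -> B \subset A -> B \in D.

(* An integer, since the complex [{set0}] has dimension -1. *)
Definition complex_dim (n : nat) (D : {set {set 'I_n}}) : int :=
  (\max_(A in D) #|A|)%N%:Z - 1.

(* [compatible D i i] holds as soon as [i] is a vertex of [D]. *)
Definition compatible (n : nat) (D : {set {set 'I_n}}) (i j : 'I_n) : bool :=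
  ([set i; j] \in D)%SET.

Definition flag_complex (n : nat) (D : {set {set 'I_n}}) : Prop :=
  [/\ simplicial_complex D,
      forall i : 'I_n, ([set i] \in D)%SET &
      forall A : {set 'I_n}, (2 < #|A|)%N ->
        (forall i j, i \in A -> j \in A -> compatible D i j) -> A \in D].

Definition two_isolated_vertices (n : nat) (D : {set {set 'I_n}}) : Prop :=
  n = 2%N /\ D = [set A : {set 'I_n} | (#|A| <= 1)%N]%SET.

(* A variety is identified with its set of points in K^n, with the Zariski
   topology. *)

Section AffineVarieties.
Variable K : closedFieldType.

Definition zero_locus (n : nat) (I : set {mpoly K[n]}) : set ('I_n -> K) :=
  [set u | forall p, I p -> p.@[u] = 0].

Definition zariski_closed (n : nat) (Z : set ('I_n -> K)) : Prop :=
  exists I : set {mpoly K[n]}, Z = zero_locus I.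

(* Irreducible subsets are non-empty. *)
Definition irreducible (n : nat) (Z : set ('I_n -> K)) : Prop :=
  Z !=set0 /\
  forall F G : set ('I_n -> K), zariski_closed F -> zariski_closed G ->
    Z `<=` F `|` G -> Z `<=` F \/ Z `<=` G.

(* [X] is meant to be Zariski closed, so that the closed subsets of [X] are
   the closed subsets of K^n contained in [X]. *)
Definition irreducible_closed_in (n : nat) (X Z : set ('I_n -> K)) : Prop :=
  [/\ zariski_closed Z, irreducible Z & Z `<=` X].

(* Z 0 < Z 1 < ... < Z d, all irreducible and closed in X; the values Z k with
   k > d are irrelevant. *)
Definition irreducible_chain (n : nat) (X : set ('I_n -> K)) (d : nat)
    (Z : nat -> set ('I_n -> K)) : Prop :=
  (forall k, (k <= d)%N -> irreducible_closed_in X (Z k)) /\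
  (forall k, (k < d)%N -> Z k `<` Z k.+1).

(* The Krull dimension is a relation, so that the empty set has none. *)
Definition has_dim (n : nat) (X : set ('I_n -> K)) (d : nat) : Prop :=
  (exists Z, irreducible_chain X d Z) /\
  (forall e Z, irreducible_chain X e Z -> (e <= d)%N).

(* Codimension in [X] of an irreducible closed subset [Y] of [X]. *)
Definition has_codim (n : nat) (X Y : set ('I_n -> K)) (d : nat) : Prop :=
  (exists2 Z, irreducible_chain X d Z & Z 0%N = Y) /\
  (forall e Z, irreducible_chain X e Z -> Z 0%N = Y -> (e <= d)%N).

Definition irreducible_component (n : nat) (X Z : set ('I_n -> K)) : Prop :=
  irreducible_closed_in X Z /\
  forall Z', irreducible_closed_in X Z' -> Z `<=` Z' -> Z' = Z.

Definition pure_codim (n : nat) (X Y : set ('I_n -> K)) (d : nat) : Prop :=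
  forall Z, irreducible_component Y Z -> has_codim X Z d.

Definition poly_map (n m : nat) (f : 'I_m -> {mpoly K[n]}) (u : 'I_n -> K) :
    'I_m -> K := fun j => (f j).@[u].

(* Regular maps between Zariski closed sets are the restrictions of
   polynomial maps of the ambient affine spaces. *)
Definition variety_iso (n m : nat)
    (X : set ('I_n -> K)) (Y : set ('I_m -> K)) : Prop :=
  exists (f : 'I_m -> {mpoly K[n]}) (g : 'I_n -> {mpoly K[m]}),
    [/\ forall u, X u -> Y (poly_map f u),
        forall v, Y v -> X (poly_map g v),
        forall u, X u -> poly_map g (poly_map f u) = u &
        forall v, Y v -> poly_map f (poly_map g v) = v].

Definition coord_subspace (n : nat) (S : {set 'I_n}) : set ('I_n -> K) :=
  [set u | forall s, s \in S -> u s = 0].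

Definition binary_eq (n : nat) (D : {set {set 'I_n}})
    (a : 'I_n -> 'I_n -> nat) (i : 'I_n) : {mpoly K[n]} :=
  'X_i + \prod_(j < n | ~~ compatible D j i) 'X_j ^+ a i j - 1.

(* The exponents [a i j] with [compatible D j i] do not occur in the
   equations and are left unconstrained. *)
Definition binary_geometry (n : nat) (D : {set {set 'I_n}})
    (U : set ('I_n -> K)) : Prop :=
  exists a : 'I_n -> 'I_n -> nat,
  [/\ forall i j, ~~ compatible D j i -> (0 < a i j)%N,
      U = zero_locus [set binary_eq D a i | i in [set: 'I_n]],
      exists2 d : nat, has_dim U d & d%:Z = complex_dim D + 1 &
      forall S : {set 'I_n},
        let US := U `&` coord_subspace S in
        (US !=set0 <-> S \in D) /\
        (S \in D -> irreducible US /\ pure_codim U US #|S|)].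

End AffineVarieties.

(* Main.v *)
Require Import Defs.
From mathcomp Require Import all_boot all_order all_algebra.
From mathcomp Require Import boolp classical_sets reals.
From mathcomp Require Import complex.
From mathcomp Require Import mpoly ring.

(** Let [Delta] have dimension 0, so that distinct vertices are incompatible
    and every equation reads [1 - u_i = \prod_(j != i) u_j ^ a_ij]. If [u_i]
    vanishes at a point of [U], then the other equations force that point to be
    [p_i], with [i]-th coordinate 0 and all others 1. So the function [u_i] is
    not identically 0 on [U] (which has more than one point), and, [U] being
    irreducible, it can be cancelled from any identity on [U]. This lets one
    expand functions on [U] in powers of [s = u_i] at [p_i]: the first
    coefficient of such an expansion is well defined ([jet_uniq]). The equation
    of [u_j] is itself an expansion, [u_j = 1 - s ^ a_ji + ...].

    At first order the [i]-th equation
    [1 - s = \prod_(j != i) (1 - s ^ a_ji + ...) ^ a_ij]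
    says that the [a_ij] with [a_ji = 1] add up to 1: there is exactly one [k]
    with [a_ki = 1], and [a_ik = 1] too ([partner]).

    Suppose there were further vertices, and let [m] be the least [a_ji] among
    them. Write [P] and [Q] for the products of the powers of the remaining
    [u_j] in the equations of [u_i] and [u_k], so that [1 - s = u_k * P] and
    [u_k = 1 - s * Q]. Then [1 - P = s * (1 - P * Q)]. As [P] and [Q] are 1 up
    to terms of order [m], the right-hand side has order at least [m + 1]; but
    the coefficient of [s ^ m] in [1 - P] is the sum of the [a_ij] with
    [a_ji = m], which is positive ([partner_only]).

    Hence there are two vertices, both exponents are 1, and [U] is the line
    [u_i + u_k = 1]. *)

Set Implicit Arguments.
Unset Strict Implicit.
Unset Printing Implicit Defensive.

Import GRing.Theory Num.Theory.
Local Open Scope classical_set_scope.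
Local Open Scope ring_scope.

(** * Binary curves over pairwise incompatible vertices *)

Section IsolatedVertices.
Variables (K : numClosedFieldType) (n : nat) (a : 'I_n -> 'I_n -> nat).
Variable U : set ('I_n -> K).
Hypothesis a_gt0 : forall i j, j != i -> (0 < a i j)%N.
Hypothesis UE : forall u,
  U u <-> forall i, u i = 1 - \prod_(j < n | j != i) u j ^+ a i j.
Hypothesis U_irr : irreducible U.
Hypothesis U_neq1 : forall v : 'I_n -> K, ~ (U `<=` [set v]).

Definition vertex_point (i : 'I_n) : 'I_n -> K := fun j => (j != i)%:R.

Lemma vertex_pointE i : vertex_point i i = 0.
Proof. by rewrite /vertex_point eqxx. Qed.

Lemma coord_eq0 i u : U u -> u i = 0 -> u = vertex_point i.
Proof.
move=> /UE Uu ui0; apply: funext => j; rewrite /vertex_point.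
have [-> // | ji] := eqVneq j i.
rewrite Uu (bigD1 i) 1?eq_sym //= ui0 expr0n.
by rewrite eqn0Ngt a_gt0 1?eq_sym // mul0r subr0.
Qed.

Lemma vertex_point_in i : U (vertex_point i).
Proof.
apply/UE => j; have [->|ji] := eqVneq j i.
  rewrite vertex_pointE big1 ?subrr // => k ki.
  by rewrite /vertex_point ki expr1n.
rewrite (bigD1 i) 1?eq_sym //= vertex_pointE expr0n.
by rewrite eqn0Ngt a_gt0 1?eq_sym // mul0r subr0 /vertex_point ji.
Qed.

Lemma zariski_closed_zeros (p : {mpoly K[n]}) :
  zariski_closed [set u | p.@[u] = 0].
Proof.
exists [set p]; apply/seteqP; split=> u /=; first by move=> pu q ->.
exact.
Qed.

(** Irreducibility makes the coordinate ring of [U] a domain, in which [u_i]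
    is nonzero since otherwise [U] would be the single point [p_i]. *)
Lemma cancel_coord i m (p : {mpoly K[n]}) :
  (forall u, U u -> u i ^+ m * p.@[u] = 0) ->
  forall u, U u -> p.@[u] = 0.
Proof.
move=> sp0; have [_ irr] := U_irr.
have [|U0|//] := irr _ _ (zariski_closed_zeros 'X_i) (zariski_closed_zeros p).
  move=> u /sp0/eqP; rewrite mulf_eq0 expf_eq0 => /orP[/andP[_]|] /eqP ?.
    by left; rewrite /= mevalXU.
  by right.
case: (@U_neq1 (vertex_point i)) => u Uu /=; apply: coord_eq0 => //.
by have /= := U0 _ Uu; rewrite mevalXU.
Qed.

(** ** Expansions in powers of a coordinate *)

(** The expansion [p = 1 - c * u_i ^ m + ...] at [vertex_point i] of the
    function [p] on [U]. Keeping the whole remainder as a polynomial factor [h],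
    of which only the value at the point matters, replaces computations in the
    local ring by polynomial identities on [U]. *)
Definition has_jet i m (p : {mpoly K[n]}) (c : K) :=
  exists2 h : {mpoly K[n]},
    forall u, U u -> p.@[u] = 1 - u i ^+ m * h.@[u] &
    h.@[vertex_point i] = c.

Lemma jet_uniq i m p c d : has_jet i m p c -> has_jet i m p d -> c = d.
Proof.
move=> [g pg <-] [h ph <-]; apply/eqP; rewrite -subr_eq0 -mevalB; apply/eqP.
apply: (@cancel_coord i m); last exact: vertex_point_in.
move=> u Uu; rewrite mevalB mulrBr; apply/eqP; rewrite subr_eq0; apply/eqP.
by have := pg _ Uu; rewrite ph // => /addrI /oppr_inj.
Qed.

Lemma jet1 i m : has_jet i m 1 0.
Proof. by exists 0 => [u _|]; rewrite ?meval0 // mulr0 subr0 meval1. Qed.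

Lemma jetM i m p q c d : (0 < m)%N ->
  has_jet i m p c -> has_jet i m q d -> has_jet i m (p * q) (c + d).
Proof.
move=> m0 [g pg <-] [h qh <-]; exists (g + h - 'X_i ^+ m * g * h).
  move=> u Uu; rewrite mevalM pg // qh // mevalB mevalD !mevalM rmorphXn /=.
  by rewrite mevalXU; ring.
rewrite mevalB mevalD !mevalM rmorphXn /= mevalXU vertex_pointE expr0n.
by rewrite eqn0Ngt m0 !mul0r subr0.
Qed.

Lemma jetX i m p c k : (0 < m)%N ->
  has_jet i m p c -> has_jet i m (p ^+ k) (c *+ k).
Proof.
move=> m0 pc; elim: k => [|k IHk]; first exact: jet1.
by rewrite exprS mulrS; apply: jetM.
Qed.

Lemma jet_prod i m (P : pred 'I_n) p c : (0 < m)%N ->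
  (forall j, P j -> has_jet i m (p j) (c j)) ->
  has_jet i m (\prod_(j < n | P j) p j) (\sum_(j < n | P j) c j).
Proof.
move=> m0 pc.
by elim/big_rec2: _ => [|j x y Pj xy]; [exact: jet1 | apply: jetM; auto].
Qed.

(** The [j]-th equation, read as an expansion; the remaining factors are all 1
    at the vertex point. *)
Lemma jet_coord i j m : j != i -> (m <= a j i)%N ->
  has_jet i m 'X_j (a j i == m)%:R.
Proof.
move=> ji ma; exists ('X_i ^+ (a j i - m) *
    \prod_(k < n | (k != j) && (k != i)) 'X_k ^+ a j k).
  move=> u /[dup] Uu /UE Uj; rewrite mevalXU Uj (bigD1 i) 1?eq_sym //=.
  rewrite mevalM rmorphXn rmorph_prod /= mevalXU mulrA -exprD subnKC //.
  by congr (1 - _ * _); apply: eq_bigr => k _; rewrite rmorphXn /= mevalXU.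
rewrite mevalM rmorphXn rmorph_prod /= mevalXU vertex_pointE expr0n subn_eq0.
rewrite [X in _ * X]big1 ?mulr1 => [|k /andP[_ ki]]; first by rewrite eqn_leq ma andbT.
by rewrite rmorphXn /= mevalXU /vertex_point ki expr1n.
Qed.

Lemma jet_coord_prod i m (P : pred 'I_n) (e : 'I_n -> nat) : (0 < m)%N ->
  (forall j, P j -> j != i) -> (forall j, P j -> (m <= a j i)%N) ->
  has_jet i m (\prod_(j < n | P j) 'X_j ^+ e j)
    (\sum_(j < n | P j) (a j i == m) * e j)%N%:R.
Proof.
move=> m0 Pi Pm; rewrite natr_sum; apply: jet_prod => // j Pj.
by rewrite natrM mulr_natr; apply: jetX => //; apply: jet_coord; auto.
Qed.

(** ** Comparison of coefficients *)

(** The coefficient of [u_i] on the two sides of the [i]-th equation. *)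
Lemma first_order i : (\sum_(j < n | j != i) (a j i == 1) * a i j = 1)%N.
Proof.
have jP := @jet_coord_prod i 1 (fun j => j != i) (a i) isT.
apply/eqP; rewrite -(eqr_nat K); apply/eqP.
apply: jet_uniq (jP _ _) _ => //; first by move=> j ji; rewrite a_gt0 1?eq_sym.
exists 1; last by rewrite meval1.
move=> u /UE Uu; rewrite meval1 mulr1 expr1 Uu opprB addrCA subrr addr0.
by rewrite rmorph_prod /=; apply: eq_bigr => j _; rewrite rmorphXn /= mevalXU.
Qed.

Lemma partner i : exists k,
  [/\ k != i, a k i = 1%N, a i k = 1%N &
      forall j, j != i -> j != k -> (1 < a j i)%N].
Proof.
have S := first_order i.
have [k /andP[ki /eqP ak]|none] := pickP (fun k => (k != i) && (a k i == 1%N)).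
  have aik : (0 < a i k)%N by rewrite a_gt0.
  move: S; rewrite (bigD1 k) //= ak eqxx mul1n => S.
  have aik1 : a i k = 1%N.
    by apply/eqP; rewrite eqn_leq aik andbT -S leq_addr.
  exists k; split=> // j ji jk; rewrite ltn_neqAle a_gt0 1?eq_sym // andbT.
  apply/negP => /eqP aj; move: S; rewrite aik1 => -[].
  rewrite (bigD1 j) /= ?ji // -aj eqxx mul1n.
  by have := @a_gt0 i j ji; case: (a i j).
by move: S; rewrite big1 // => j ji; have := none j; rewrite ji /= => ->.
Qed.

(** Eliminating [u_k] between the equations of [u_i] and [u_k] cancels the terms
    of order 1, so that the next order [m] becomes visible. *)
Lemma partner_only i k : k != i -> a k i = 1%N -> a i k = 1%N ->
  (forall j, j != i -> j != k -> (1 < a j i)%N) ->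
  forall j, j != i -> j = k.
Proof.
move=> ki aki aik a_gt1 l li; apply/eqP/negPn/negP => lk.
pose B j := (j != i) && (j != k).
have Bl : B l by rewrite /B li lk.
case: (arg_minnP (fun j => a j i) Bl) => j0 Bj0 j0min.
pose m := a j0 i.
have m0 : (0 < m)%N by case/andP: Bj0 => ? ?; rewrite a_gt0 1?eq_sym.
have jetB e := @jet_coord_prod i m B e m0 (fun j Bj => proj1 (andP Bj)) j0min.
have prodE (e : 'I_n -> nat) (u : 'I_n -> K) :
    (\prod_(j < n | B j) 'X_j ^+ e j : {mpoly K[n]}).@[u] =
    \prod_(j < n | B j) u j ^+ e j.
  by rewrite rmorph_prod; apply: eq_bigr => j _; rewrite rmorphXn /= mevalXU.
have [h PQh _] := jetM m0 (jetB (a i)) (jetB (a k)).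
(* [1 - P = u_i * (1 - P * Q)], and [P * Q] is 1 up to order [m]. *)
have jP0 : has_jet i m (\prod_(j < n | B j) 'X_j ^+ a i j) 0.
  exists ('X_i * h); last by rewrite mevalM mevalXU vertex_pointE mul0r.
  move=> u Uu; rewrite mevalM mevalXU mulrCA.
  have -> : u i ^+ m * h.@[u] = 1 - (\prod_(j < n | B j) 'X_j ^+ a i j
      * \prod_(j < n | B j) 'X_j ^+ a k j : {mpoly K[n]}).@[u].
    by rewrite PQh // opprB addrCA subrr addr0.
  rewrite mevalM !prodE.
  have ek : u k = 1 - u i * \prod_(j < n | B j) u j ^+ a k j.
    move/UE: (Uu) => ->; rewrite (bigD1 i) 1?eq_sym //= aki expr1.
    by congr (1 - _ * _); apply: eq_bigl => j; rewrite /B andbC.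
  have ei : u i = 1 - u k * \prod_(j < n | B j) u j ^+ a i j.
    by move/UE: (Uu) => {1}->; rewrite (bigD1 k) //= aik expr1.
  move: ei; rewrite ek; set P := \prod_(_ < _ | _) _; set Q := \prod_(_ < _ | _) _.
  by move=> ei; rewrite mulrBr mulr1 {1}ei; ring.
have := jet_uniq (jetB (a i)) jP0; rewrite -[0]/(0%:R) => /eqP.
case/andP: (Bj0) => j0i _.
rewrite eqr_nat (bigD1 j0) //= eqxx mul1n addn_eq0 => /andP[+ _].
by rewrite eqn0Ngt a_gt0.
Qed.

Lemma binary_curve : exists i k : 'I_n,
  [/\ k != i, forall j, j != i -> j = k &
      forall u, U u <-> u k = 1 - u i].
Proof.
have [i _] : exists _ : 'I_n, True.
  apply: contrapT => n0; have [[u _] _] := U_irr; case: (@U_neq1 u) => v _.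
  by apply: funext => i; case: n0; exists i.
have [k [ki aki aik a1]] := partner i.
have only := partner_only ki aki aik a1.
have Ui u : \prod_(j < n | j != i) u j ^+ a i j = u k :> K.
  rewrite (bigD1 k) //= aik big1 ?mulr1 // => j /andP[ji].
  by rewrite (only j) ?eqxx.
have Uk u : \prod_(j < n | j != k) u j ^+ a k j = u i :> K.
  rewrite (bigD1 i) 1?eq_sym //= aki big1 ?mulr1 // => j /andP[jk ji].
  by rewrite (only j) ?eqxx in jk.
exists i, k; split=> // u; rewrite UE; split=> [/(_ k)|ek j]; first by rewrite Uk.
have [->|/only ->] := eqVneq j i; last by rewrite Uk.
by rewrite Ui ek opprB addrCA subrr addr0.
Qed.

End IsolatedVertices.

(** * Dimensions, complexes and the line *)

Lemma has_dim_uniq (K : closedFieldType) n (X : set ('I_n -> K)) d e :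
  has_dim X d -> has_dim X e -> d = e.
Proof.
move=> [[Y Yd] dX] [[Z Ze] eX]; apply/eqP; rewrite eqn_leq.
by rewrite (eX _ _ Yd) (dX _ _ Ze).
Qed.

Lemma has_dim1_neq1 (K : closedFieldType) n (X : set ('I_n -> K)) v :
  has_dim X 1 -> ~ (X `<=` [set v]).
Proof.
move=> [[Z [ZX Zlt]] _] Xv; have [Z01 Z10] := Zlt 0%N isT; apply: Z10.
have [_ [[w Zw] _] Z0X] := ZX 0%N isT; have [_ _ Z1X] := ZX 1%N isT.
by move=> x /Z1X/Xv ->; rewrite -(Xv _ (Z0X _ Zw)).
Qed.

Lemma complex_dim0P n (D : {set {set 'I_n}}) :
  flag_complex D -> complex_dim D = 0 ->
  D = [set A : {set 'I_n} | (#|A| <= 1)%N]%SET.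
Proof.
move=> [[D0 Dsub] D1 _] /eqP; rewrite subr_eq0 => /eqP[Dmax].
apply/setP => A; rewrite inE; apply/idP/idP => [AD|].
  by rewrite -Dmax (leq_bigmax_cond _ AD).
rewrite leq_eqVlt ltnS leqn0 cards_eq0 => /orP[/cards1P[i ->]|/eqP->] //.
have /set0Pn[B BD] : D != finset.set0 by apply/eqP; exact: D0.
by apply: Dsub BD _; rewrite finset.sub0set.
Qed.

Lemma binary_eqE (K : closedFieldType) n (D : {set {set 'I_n}}) a i
    (u : 'I_n -> K) :
  D = [set A : {set 'I_n} | (#|A| <= 1)%N]%SET ->
  (binary_eq K D a i).@[u] = 0 <->
  u i = 1 - \prod_(j < n | j != i) u j ^+ a i j.
Proof.
move=> ->; rewrite /binary_eq mevalB mevalD mevalXU meval1 rmorph_prod.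
under eq_bigl => j do rewrite /compatible inE cards2 ltnS leqNgt lt0b negbK.
under eq_bigr => j _ do rewrite rmorphXn /= mevalXU.
split=> [/eqP|->]; last by rewrite subrK subrr.
by rewrite subr_eq0 => /eqP uE; apply/eqP; rewrite eq_sym subr_eq uE.
Qed.

(** Parametrized by [u_i], with inverse [t |-> (t, 1 - t)]. *)
Lemma line_iso (K : closedFieldType) n (U : set ('I_n -> K)) i k :
  k != i -> (forall j, j != i -> j = k) ->
  (forall u, U u <-> u k = 1 - u i) ->
  variety_iso U [set: 'I_1 -> K].
Proof.
move=> ki only UE.
exists (fun=> 'X_i), (fun j => if j == i then 'X_ord0 else 1 - 'X_ord0).
split=> //.
- by move=> v _; apply/UE; rewrite /poly_map eqxx (negPf ki) mevalB meval1.
- move=> u /UE Uu; apply: funext => j; rewrite /poly_map.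
  have [->|/only ->] := eqVneq j i; first by rewrite !mevalXU.
  by rewrite mevalB meval1 !mevalXU Uu.
- by move=> v _; apply: funext => j; rewrite /poly_map mevalXU eqxx mevalXU (ord1 j).
Qed.

(* C is R[i], the complex numbers over the real numbers R; the affine line C is
   the whole affine space with one coordinate. *)
Theorem theorem2p9 (R : realType) (n : nat) (D : {set {set 'I_n}})
    (U : set ('I_n -> R[i])) :
  flag_complex D -> binary_geometry D U -> has_dim U 1 ->
  two_isolated_vertices D /\ variety_iso U [set: 'I_1 -> R[i]].
Proof.
move=> flagD [a [a_gt0 UE [d dU dD] strata]] dimU.
have D_iso : D = [set A : {set 'I_n} | (#|A| <= 1)%N]%SET.
  apply: complex_dim0P => //; apply: (addIr 1).
  by rewrite add0r -dD (has_dim_uniq dU dimU).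
have [i [k [ki only Uik]]] : exists i k : 'I_n,
  [/\ k != i, forall j, j != i -> j = k & forall u, U u <-> u k = 1 - u i].
  apply: (@binary_curve _ n a).
  - move=> i j ji; apply: a_gt0.
    by rewrite D_iso /compatible inE cards2 ji.
  - move=> u; rewrite UE; split=> [Uu i|Uu p [i _ <-]].
      by apply/binary_eqE; [exact: D_iso|apply: Uu; exists i].
    exact/binary_eqE.
  - have [_ []] := strata finset.set0; first by rewrite D_iso inE cards0.
    rewrite (_ : coord_subspace _ = setT) ?setIT //.
    by apply/seteqP; split=> // u _ j; rewrite inE.
  - by move=> v; exact: has_dim1_neq1.
split; last exact: line_iso ki only Uik.
split=> //; rewrite -[LHS]card_ord -cardsT (_ : [set: 'I_n]%SET = [set k; i]%SET).
  by rewrite cards2 ki.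
apply/setP => j; rewrite !inE.
by have [|/only ->] := eqVneq j i; rewrite ?orbT ?eqxx.
Qed.
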